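(* The triple $\left(\mathfrak g(A),\blacktriangleright_w,[-,-]_{\cdot}\right)$ is a post-Lie algebra.
   Context: $\mathbf{k}$ is a field of characteristic zero and $A$ is a finite set. Alphabet and weights. $\mathcal Z_A=\{z_i^a \mid a\in A,\ i\in\mathbb Z_{\ge -1}\}$ and $\overline{\mathrm{PN}}(A)=\mathbf{k}\langle \mathcal Z_A\rangle$ is the free unital associative algebra on $\mathcal Z_A$. Monomials are words $x_1\cdots x_p$ with $x_j\in\mathcal Z_A$. The weight is $\mathrm{wt}(z_i^a)=i$ and $\mathrm{wt}(x_1\cdots x_p)=\sum_j\mathrm{wt}(x_j)$. $\overline{\mathrm{PN}}(A)_{\le 0}$ is the linear span of the monomials of weight $\le 0$; it is a Lie algebra for the commutator bracket $[x,y]_{\cdot}=xy-yx$. On letters put $\partial(z_i^a)=z_{i+1}^a$, and let $\partial^m$ be its $m$-fold iterate ($m\ge 0$). Generators. $V(A)\subseteq\overline{\mathrm{PN}}(A)$ is the linear span of the monomials $z_{i_1}^{a_1}\cdots z_{i_p}^{a_p}$ with $\sum_{r=1}^p i_r=-1$ and $\sum_{r=1}^q i_r\ge 0$ for all $1\le q<p$. $\mathfrak g(A)$ is the Lie subalgebra of $(\overline{\mathrm{PN}}(A)_{\le 0},[-,-]_{\cdot})$ generated by $V(A)$. Insertion product. For monomials $\mathbf x$ and $\mathbf y=y_1\cdots y_q$ in $\overline{\mathrm{PN}}(A)_{\le 0}$ (with $y_j\in \mathcal Z_A$) set $$\mathbf x\blacktriangleright_w\mathbf y=\sum_{j=1}^q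 y_1\cdots y_{j-1}\,\partial^{-\mathrm{wt}(\mathbf x)}(y_j)\,\mathbf x\,y_{j+1}\cdots y_q,$$ extended bilinearly to $\overline{\mathrm{PN}}(A)_{\le 0}$. On $\mathfrak g(A)$, $\blacktriangleright_w$ denotes the restriction of this product (part of the assertion is that it takes values in $\mathfrak g(A)$). Post-Lie algebra. A post-Lie algebra $(\mathbf g,\blacktriangleright,[-,-])$ is a Lie algebra $(\mathbf g,[-,-])$ with a bilinear product $\blacktriangleright$ such that for all $x,y,z$: $x\blacktriangleright[y,z]=[x\blacktriangleright y,z]+[y,x\blacktriangleright z]$ and $[x,y]\blacktriangleright z=a_\blacktriangleright(x,y,z)-a_\blacktriangleright(y,x,z)$, where $a_\blacktriangleright(x,y,z)=x\blacktriangleright(y\blacktriangleright z)-(x\blacktriangleright y)\blacktriangleright z$. *)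

(* Defs.v *)
From HB Require Import structures.
From mathcomp Require Import all_boot all_order all_algebra.
From mathcomp Require Import finmap.
From mathcomp Require Import boolp.
From mathcomp Require Import monalg.

Set Implicit Arguments.
Unset Strict Implicit.
Unset Printing Implicit Defensive.

Import Order.TTheory GRing.Theory Num.Theory.
Local Open Scope ring_scope.

Section LieStructures.
Variables (k : fieldType) (L : lmodType k).

Definition bilinear_op (op : L -> L -> L) : Prop :=
  (forall x, linear (op x)) /\ (forall y, linear (op ^~ y)).

Record lie_algebra (br : L -> L -> L) : Prop := LieAlgebra {
  lie_bilinear : bilinear_op br;
  lie_alternating : forall x, br x x = 0;
  lie_jacobi : forall x y z,
    br x (br y z) + br y (br z x) + br z (br x y) = 0
}.

Definition associator (tr : L -> L -> L) (x y z : L) : L :=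
  tr x (tr y z) - tr (tr x y) z.

Record post_lie_algebra (tr br : L -> L -> L) : Prop := PostLieAlgebra {
  post_lie_lie : lie_algebra br;
  post_lie_bilinear : bilinear_op tr;
  post_lie_derivation : forall x y z,
    tr x (br y z) = br (tr x y) z + br y (tr x z);
  post_lie_associator : forall x y z,
    tr (br x y) z = associator tr x y z - associator tr y x z
}.

Definition linear_span (S : L -> Prop) (x : L) : Prop :=
  exists s : seq (k * L),
    (forall p, p \in s -> S p.2) /\ x = \sum_(p <- s) p.1 *: p.2.

Record lie_subalgebra (br : L -> L -> L) (S : L -> Prop) : Prop :=
  LieSubalgebra {
  lie_sub0 : S 0;
  lie_subZD : forall (a : k) x y, S x -> S y -> S (a *: x + y);
  lie_sub_br : forall x y, S x -> S y -> S (br x y)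
}.

(* The Lie subalgebra of [M] (itself a Lie subalgebra of [L]) generated by
   [V]: the intersection of all Lie subalgebras [S] with V <= S <= M. *)
Definition lie_generated (br : L -> L -> L) (M V : L -> Prop) (x : L) : Prop :=
  forall S : L -> Prop, lie_subalgebra br S ->
    (forall y, S y -> M y) -> (forall y, V y -> S y) -> S x.

Lemma lie_generated_lie_subalgebra br M V :
  lie_subalgebra br (lie_generated br M V).
Proof.
split.
- by move=> S [].
- move=> a x y hx hy S hS hM hV; case: (hS) => _ + _; apply.
  + exact: hx.
  + exact: hy.
- move=> x y hx hy S hS hM hV; case: (hS) => _ _; apply.
  + exact: hx.
  + exact: hy.
Qed.

End LieStructures.

(* The pair (a, n) stands for the letter z_{n-1}^a, so that the index n - 1
   ranges over the integers >= -1. *)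
Notation letter A := (A * nat)%type.
Notation word A := {fmonom letter A}.

(* The free unital associative algebra k<Z_A>: finitely supported functions
   on words, with << w >> the basis element of the word w. *)
Notation PN k A := {malg k[word A]}.

Section InsertionPostLie.
Variables (k : fieldType) (A : finType).
Local Notation letter := (letter A).
Local Notation word := (word A).
Local Notation PN := (PN k A).

Definition letter_wt (l : letter) : int := (l.2)%:Z - 1.

Definition wt (s : seq letter) : int := \sum_(l <- s) letter_wt l.

Definition partial (l : letter) : letter := (l.1, l.2.+1).

Definition commutator (x y : PN) : PN := x * y - y * x.

Definition PN_le0 : PN -> Prop :=
  linear_span (fun x : PN => exists2 w : word, wt w <= 0 & x = << w >>).

Definition generating_word (w : word) : Prop :=
  wt w = -1 /\
  (forall q, (1 <= q)%N -> (q < size w)%N -> 0 <= wt (take q w)).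

Definition V : PN -> Prop :=
  linear_span (fun x : PN => exists2 w : word, generating_word w & x = << w >>).

Definition in_g : PN -> Prop := lie_generated commutator PN_le0 V.

(* Only used for [x] of weight <= 0, where `|wt x|%N is -wt(x). *)
Definition insert_word (x y : word) : PN :=
  \sum_(j < size y)
     << FMonom (take j y
                ++ iter `|wt x|%N partial (tnth (in_tuple y) j)
                :: x ++ drop j.+1 y) >>.

(* The bilinear extension; it is the insertion product on PN_le0, its values
   elsewhere are irrelevant. *)
Definition insertion (x y : PN) : PN :=
  \sum_(v <- msupp x) \sum_(w <- msupp y) (x@_v * y@_w) *: insert_word v w.

Definition g_pred : {pred PN} := fun x => `[< in_g x >].

Lemma g_predP x : reflect (in_g x) (x \in g_pred).
Proof. exact: asboolP. Qed.

Lemma g_pred_submod_closed : submod_closed g_pred.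
Proof.
have [g0 gZD _] := lie_generated_lie_subalgebra commutator PN_le0 V.
split; first exact/g_predP.
by move=> a x y /g_predP hx /g_predP hy; apply/g_predP; exact: gZD hx hy.
Qed.

HB.instance Definition _ :=
  GRing.isSubmodClosed.Build k PN g_pred g_pred_submod_closed.

Record g : Type := G { g_val : PN; g_valP : g_val \in g_pred }.
HB.instance Definition _ := [isSub for g_val].
HB.instance Definition _ := [Choice of g by <:].
HB.instance Definition _ := [SubChoice_isSubLmodule of g by <:].

Lemma g_bracket_subproof (x y : g) : commutator (g_val x) (g_val y) \in g_pred.
Proof.
have [_ _ gbr] := lie_generated_lie_subalgebra commutator PN_le0 V.
by apply/g_predP; apply: (gbr _ _ (g_predP _ (g_valP x)) (g_predP _ (g_valP y))).
Qed.

Definition g_bracket (x y : g) : g := G (g_bracket_subproof x y).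

End InsertionPostLie.

(* Main.v *)
From HB Require Import structures.
Require Import Defs.
From mathcomp Require Import all_boot all_order all_algebra.
From mathcomp Require Import ssrAC finmap boolp monalg zify.
Set Implicit Arguments.
Unset Strict Implicit.
Unset Printing Implicit Defensive.
Import Order.TTheory GRing.Theory Num.Theory.
Local Open Scope ring_scope.

(** Write D_x for the map y |-> x |> y.

    The axioms. Inserting x into a word after each of its letters in turn, while
    shifting that letter by -wt(x), is what a derivation does: D_x is the
    derivation of the free algebra with D_x(z) = d^n(z) x on a letter z, where d
    raises the index and n = -wt(x) ([ins_leibniz], [ins_mon_letter]). Being a
    derivation of the product it is a derivation of the commutator, which is the
    first axiom. The second one says that D_{[x,y]} and
    [D_x, D_y] - D_{x |> y} + D_{y |> x} agree. Both are derivations, so only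
    letters matter; there, if x and y are homogeneous of weights -n and -m, then
    D_x D_y z = d^{n+m}(z) x y + d^m(z) (x |> y), and the last term is
    D_{x |> y} z because the insertion of x does not change weights
    ([ins_mon_homog]). Hence x |> (y |> z) - (x |> y) |> z - (x y) |> z vanishes on
    letters ([assoc_defect_letter]), and it is symmetric in x and y everywhere
    ([assoc_defect_sym]).

    Closure of the generated Lie algebra. Read a word as a walk whose steps are
    the weights of its letters, and call it a first passage word when its final
    height is negative and the walk stays strictly above it until the end; as no
    step goes down by more than 1, this says that the walk hits its final height
    for the first time at the end. The words spanning V
    are the first passage words of weight -1. First passage words are stable
    under concatenation, so their span contains the Lie algebra generated by V.
    Inserting a first passage word of weight -n into a generating word after a
    letter raised by n gives a generating word: the raise lifts the walk by
    exactly the depth of the excursion that follows ([generating_insert]).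
    So D_x maps V to V for every x in the Lie algebra, and being a derivation it
    maps the Lie algebra to itself ([ins_generated_closed]). *)

(** * Linear spans *)

Section LinearSpan.
Variables (k : fieldType) (L : lmodType k).
Implicit Types (S P : L -> Prop).

Lemma linear_span_min S P :
    P 0 -> (forall (a : k) x y, P x -> P y -> P (a *: x + y)) ->
    (forall x, S x -> P x) ->
  forall x, linear_span S x -> P x.
Proof.
move=> P0 PZD SP x [s [sS ->]]; elim: s sS => [|p s IH] sS; first by rewrite big_nil.
rewrite big_cons; apply: PZD; first exact/SP/sS/mem_head.
by apply: IH => q qs; apply: sS; rewrite inE qs orbT.
Qed.

Lemma linear_span_sub S x : S x -> linear_span S x.
Proof.
move=> Sx; exists [:: (1, x)]; split; last by rewrite big_seq1 scale1r.
by move=> p; rewrite inE => /eqP->.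
Qed.

Lemma linear_span0 S : linear_span S 0.
Proof. by exists [::]; split; rewrite ?big_nil. Qed.

Lemma linear_spanZD S (a : k) x y :
  linear_span S x -> linear_span S y -> linear_span S (a *: x + y).
Proof.
move=> [s [sS ->]] [t [tS ->]]; exists ([seq (a * p.1, p.2) | p <- s] ++ t).
split=> [p|].
  by rewrite mem_cat => /orP[/mapP[q qs ->]|/tS//]; apply: (sS q).
rewrite big_cat big_map /= scaler_sumr; congr (_ + _).
by apply: eq_bigr => p _; rewrite scalerA.
Qed.

Lemma linear_span_sum S (I : Type) (r : seq I) (F : I -> L) :
  (forall i, linear_span S (F i)) -> linear_span S (\sum_(i <- r) F i).
Proof.
move=> SF; elim/big_rec: _ => [|i x _ Sx]; first exact: linear_span0.
by rewrite -[F i]scale1r; apply: linear_spanZD.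
Qed.

End LinearSpan.

(** * Linear extension from a basis *)

Section FreeModule.
Variables (k : fieldType) (K : choiceType).
Local Notation malgK := {malg k[K]}.

(** The sum defining a linear extension may run over any finite set containing
    the support, so that the sums for x, y and a *: x + y have a common range. *)
Lemma malg_sum_supp (M : lmodType k) (h : K -> M) (d : {fset K}) (x : malgK) :
    (msupp x `<=` d)%fset ->
  \sum_(v <- msupp x) x@_v *: h v = \sum_(v <- d) x@_v *: h v.
Proof.
move=> le; rewrite (big_fset_incl _ le) // => v _ /mcoeff_outdom ->.
exact: scale0r.
Qed.

Lemma malg_sum_linear (M : lmodType k) (h : K -> M) :
  linear (fun x : malgK => \sum_(v <- msupp x) x@_v *: h v).
Proof.
move=> a x y; pose d := (msupp x `|` msupp y)%fset.
have dx : (msupp x `<=` d)%fset by exact: fsubsetUl.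
have dy : (msupp y `<=` d)%fset by exact: fsubsetUr.
have dxy : (msupp (a *: x + y) `<=` d)%fset.
  apply: fsubset_trans (msuppD_le _ _) _; rewrite fsubUset dy andbT.
  exact: fsubset_trans (msuppZ_le _ _) dx.
rewrite (malg_sum_supp _ dx) (malg_sum_supp _ dy) (malg_sum_supp _ dxy).
rewrite scaler_sumr -big_split; apply: eq_bigr => v _ /=.
by rewrite mcoeffD mcoeffZ scalerDl scalerA.
Qed.

Lemma malgUZ (a : k) (v : K) : << a *g v >> = a *: << v >> :> malgK.
Proof.
by apply/malgP=> u; rewrite mcoeffZ !mcoeffU; case: eqP; rewrite ?mulr1 ?mulr0.
Qed.

Lemma malg_ind (P : malgK -> Prop) :
    P 0 -> (forall (a : k) x y, P x -> P y -> P (a *: x + y)) ->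
    (forall v, P << v >>) ->
  forall x, P x.
Proof.
move=> P0 PZD PU x; rewrite [x]monalgE; elim/big_rec: _ => // v y _ Py.
by rewrite malgUZ; exact: PZD.
Qed.

End FreeModule.

(** * Monoid algebras over a commutative ring *)

Section MonoidAlgebra.
Variables (K : monomType) (R : comNzRingType).

Fact malg_scalerAr (c : R) (x y : {malg R[K]}) : c *: (x * y) = x * (c *: y).
Proof.
rewrite (malgMEw (fsubset_refl _) (msuppZ_le c y)) malgME scaler_sumr.
apply: eq_bigr => u _; rewrite scaler_sumr; apply: eq_bigr => v _.
by rewrite mcoeffZ mulrCA; apply/malgP=> w; rewrite mcoeffZ !mcoeffU mulrnAr.
Qed.

(** Over a noncommutative monoid; not a canonical structure, since the canonical
    algebra structure of monoid algebras is the one of commutative monoids. *)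
Definition malg_algType : algType R :=
  HB.pack {malg R[K]} (GRing.Lalgebra_isAlgebra.Build R {malg R[K]} malg_scalerAr).

End MonoidAlgebra.

(** * The commutator bracket of an associative algebra *)

Section Commutator.
Variables (k : fieldType) (R : algType k).

Definition bracket (x y : R) : R := x * y - y * x.

Lemma leibniz_bracket (D : R -> R) :
    (forall x y, D (x - y) = D x - D y) ->
    (forall x y, D (x * y) = D x * y + x * D y) ->
  forall x y, D (bracket x y) = bracket (D x) y + bracket x (D y).
Proof.
move=> DB DM x y; rewrite /bracket DB !DM opprD.
by rewrite [X in _ + X]addrC addrACA.
Qed.

Lemma bracket_linearr x : linear (bracket x).
Proof.
move=> a y z; rewrite /bracket mulrDl mulrDr -scalerAl -scalerAr.
by rewrite opprD addrACA scalerBr.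
Qed.

Lemma bracketC x y : bracket x y = - bracket y x.
Proof. by rewrite /bracket opprB. Qed.

Lemma bracket_lie_algebra : lie_algebra bracket.
Proof.
split.
- split=> [x|y a x z] /=; first exact: bracket_linearr.
  by rewrite bracketC bracket_linearr opprD -scalerN -!bracketC.
- by move=> x; apply: subrr.
(* The map [x, -] is itself a derivation of the product, so the Jacobi identity
   says that a derivation of the product is one of the bracket. *)
move=> x y z; rewrite (@leibniz_bracket (bracket x)) => [|u v|u v].
- have bracketNr a b : bracket a (- b) = - bracket a b.
    by rewrite /bracket mulrN mulNr opprK opprB addrC.
  rewrite [bracket (bracket x y) z]bracketC [bracket x z]bracketC bracketNr.
  by rewrite subrK addNr.
- by rewrite -scaleN1r addrC bracket_linearr scaleN1r addrC.
by rewrite /bracket mulrBl mulrBr !mulrA addrA subrK.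
Qed.

End Commutator.

(** * Insertion into words *)

Section WordAlgebra.
Variables (k : fieldType) (A : finType).
Local Notation letter := (letter A).
Local Notation word := (word A).
Variables (R : algType k) (mon : word -> R) (ins : R -> R -> R).
Local Notation partial := (@partial A).
Implicit Types (x y z : R) (u v w : word) (s t : seq letter) (l : letter).
Implicit Types (P : word -> Prop).

(* Everything below follows from these properties: R is spanned by the words
   [mon w], which multiply by concatenation, and [ins] is the bilinear map given
   on words by insertion. *)
Hypothesis mon_nil : mon (FMonom [::]) = 1.
Hypothesis mon_cat : forall s t,
  mon (FMonom (s ++ t)) = mon (FMonom s) * mon (FMonom t).
Hypothesis mon_ind : forall Q : R -> Prop,
  Q 0 -> (forall (a : k) x y, Q x -> Q y -> Q (a *: x + y)) ->
  (forall w, Q (mon w)) -> forall x, Q x.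
Hypothesis insZDl : forall (a : k) x y z,
  ins (a *: x + y) z = a *: ins x z + ins y z.
Hypothesis insZDr : forall (a : k) x y z,
  ins x (a *: y + z) = a *: ins x y + ins x z.
Hypothesis ins_mon : forall u v,
  ins (mon u) (mon v) =
    \sum_(j < size v)
       mon (FMonom (take j v ++ iter `|wt u|%N partial (tnth (in_tuple v) j)
              :: u ++ drop j.+1 v)).

Lemma mon_mul u v : mon u * mon v = mon (FMonom (u ++ v)).
Proof. by rewrite mon_cat !fmK. Qed.

Lemma insDl x y z : ins (x + y) z = ins x z + ins y z.
Proof. by rewrite -[x]scale1r insZDl !scale1r. Qed.

Lemma insDr x y z : ins x (y + z) = ins x y + ins x z.
Proof. by rewrite -[y]scale1r insZDr !scale1r. Qed.

Lemma ins0l y : ins 0 y = 0.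
Proof. by apply: (addrI (ins 0 y)); rewrite -insDl !addr0. Qed.

Lemma ins0r x : ins x 0 = 0.
Proof. by apply: (addrI (ins x 0)); rewrite -insDr !addr0. Qed.

Lemma insBl x y z : ins (x - y) z = ins x z - ins y z.
Proof. by rewrite addrC -scaleN1r insZDl scaleN1r addrC. Qed.

Lemma insBr x y z : ins x (y - z) = ins x y - ins x z.
Proof. by rewrite addrC -scaleN1r insZDr scaleN1r addrC. Qed.

Lemma ins_mon_nil u : ins (mon u) 1 = 0.
Proof. by rewrite -mon_nil ins_mon big_ord0. Qed.

Lemma ins_mon_cons u l t :
  ins (mon u) (mon (FMonom (l :: t))) =
    mon (FMonom (iter `|wt u|%N partial l :: u ++ t))
    + mon (FMonom [:: l]) * ins (mon u) (mon (FMonom t)).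
Proof.
rewrite !ins_mon big_ord_recl /= drop0; congr (_ + _).
rewrite mulr_sumr; apply: eq_bigr => j _.
by rewrite -mon_cat /= !(tnth_nth l).
Qed.

(** Together with the Leibniz rule this characterizes insertion: a letter is
    replaced by its shift followed by the inserted word. *)
Lemma ins_mon_letter u l :
  ins (mon u) (mon (FMonom [:: l])) =
    mon (FMonom [:: iter `|wt u|%N partial l]) * mon u.
Proof.
by rewrite ins_mon_cons mon_nil ins_mon_nil mulr0 addr0 cats0 mon_mul.
Qed.

Lemma ins_mon_cat u s t :
  ins (mon u) (mon (FMonom (s ++ t))) =
    ins (mon u) (mon (FMonom s)) * mon (FMonom t)
    + mon (FMonom s) * ins (mon u) (mon (FMonom t)).
Proof.
elim: s => [|l s IH]; first by rewrite mon_nil ins_mon_nil mul0r add0r mul1r.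
rewrite cat_cons !ins_mon_cons IH -[l :: s]cat1s mon_cat mulrDl mulrDr -!mulrA.
by rewrite addrA -mon_cat cat_cons catA.
Qed.

(** An insertion into a product happens in one of the two factors, because a
    word is inserted after an existing letter. *)
Lemma ins_leibniz x y z : ins x (y * z) = ins x y * z + y * ins x z.
Proof.
elim/mon_ind: x => [|a x x' IHx IHx'|u].
- by rewrite !ins0l mul0r mulr0 addr0.
- rewrite !insZDl IHx IHx' mulrDl mulrDr -scalerAr -scalerAl scalerDr.
  exact: addrACA.
elim/mon_ind: y => [|a y y' IHy IHy'|v].
- by rewrite !(mul0r, ins0r) addr0.
- rewrite insZDr !mulrDl -!scalerAl insZDr IHy IHy' scalerDr.
  exact: addrACA.
elim/mon_ind: z => [|a z z' IHz IHz'|w].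
- by rewrite !(mulr0, ins0r) addr0.
- rewrite insZDr !mulrDr -!scalerAr insZDr IHz IHz' scalerDr.
  exact: addrACA.
by rewrite mon_mul ins_mon_cat !fmK.
Qed.

Lemma ins1r x : ins x 1 = 0.
Proof.
by apply: (addrI (ins x 1)); have := ins_leibniz x 1 1; rewrite !mulr1 mul1r addr0.
Qed.

Lemma ins_bracket x y z :
  ins x (bracket y z) = bracket (ins x y) z + bracket y (ins x z).
Proof. exact: leibniz_bracket (insBr x) (ins_leibniz x) y z. Qed.

(** * The associator identity *)

Lemma wt_cat s t : wt (s ++ t) = wt s + wt t.
Proof. exact: big_cat. Qed.

Lemma wt_cons l s : wt (l :: s) = letter_wt l + wt s.
Proof. exact: big_cons. Qed.

Lemma wt_nil : wt ([::] : seq letter) = 0.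
Proof. exact: big_nil. Qed.

Lemma letter_wt_iter n l : letter_wt (iter n partial l) = letter_wt l + n%:Z.
Proof.
elim: n => [|n IH] /=; first by rewrite addr0.
by move: IH; rewrite /letter_wt /=; lia.
Qed.

Definition word_span P : R -> Prop :=
  linear_span (fun x => exists2 w, P w & x = mon w).

Lemma word_span_mon P w : P w -> word_span P (mon w).
Proof. by move=> Pw; apply: linear_span_sub; exists w. Qed.

Lemma word_spanS P Q x : (forall w, P w -> Q w) -> word_span P x -> word_span Q x.
Proof.
move=> PQ; move: x; apply: linear_span_min; first exact: linear_span0.
  by move=> *; apply: linear_spanZD.
by move=> x [w Pw ->]; apply/word_span_mon/PQ.
Qed.

(** For showing that the words occurring in an insertion all have some property,
    by looking at the letter after which the insertion takes place. *)
Lemma word_span_ins P u v :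
    (forall s l t, fmonom_val v = s ++ l :: t ->
       P (FMonom (s ++ iter `|wt u|%N partial l :: u ++ t))) ->
  word_span P (ins (mon u) (mon v)).
Proof.
move=> Pins; rewrite ins_mon; apply: linear_span_sum => j.
apply/word_span_mon/Pins; rewrite (tnth_nth (tnth (in_tuple v) j)).
by rewrite -drop_nth // cat_take_drop.
Qed.

(** The shift of the letter compensates for the weight of the inserted word. It
    is here that the weight of u must not be positive: the shift is the absolute
    value of the weight. *)
Lemma ins_mon_homog u v :
  wt u <= 0 -> word_span (fun w => wt w = wt v) (ins (mon u) (mon v)).
Proof.
move=> u0; apply: word_span_ins => s l t ->.
rewrite /= !(wt_cat, wt_cons) letter_wt_iter; lia.
Qed.

Lemma ins_homog_letter (n : int) x l :
    word_span (fun w => wt w = n) x ->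
  ins x (mon (FMonom [:: l])) = mon (FMonom [:: iter `|n|%N partial l]) * x.
Proof.
move: x; apply: linear_span_min => [|a x y IHx IHy|x [w <- ->]].
- by rewrite ins0l mulr0.
- by rewrite insZDl IHx IHy mulrDr -scalerAr.
exact: ins_mon_letter.
Qed.

(** The post-Lie identity for x and y amounts to the symmetry of this expression
    in x and y. *)
Definition assoc_defect x y z : R := associator ins x y z - ins (x * y) z.

Lemma assoc_defectZDl (a : k) x x' y z :
  assoc_defect (a *: x + x') y z =
    a *: assoc_defect x y z + assoc_defect x' y z.
Proof.
rewrite /assoc_defect /associator mulrDl -scalerAl !insZDl !scalerBr !opprD.
by rewrite [X in X + _ = _]addrACA [LHS]addrACA.
Qed.

Lemma assoc_defectZDr (a : k) x y y' z :
  assoc_defect x (a *: y + y') z =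
    a *: assoc_defect x y z + assoc_defect x y' z.
Proof.
rewrite /assoc_defect /associator mulrDr -scalerAr !(insZDl, insZDr).
by rewrite !scalerBr !opprD [X in X + _ = _]addrACA [LHS]addrACA.
Qed.

Lemma assoc_defect0l y z : assoc_defect 0 y z = 0.
Proof. by rewrite /assoc_defect /associator mul0r !ins0l !subrr. Qed.

Lemma assoc_defect0r x z : assoc_defect x 0 z = 0.
Proof. by rewrite /assoc_defect /associator mulr0 !(ins0l, ins0r) !subrr. Qed.

(** Inserting u after inserting v into a letter either puts u directly after the
    letter, which is the insertion of the product u v, or puts it inside v, which
    is the insertion of u |> v. *)
Lemma assoc_defect_letter u v l : wt u <= 0 -> wt v <= 0 ->
  assoc_defect (mon u) (mon v) (mon (FMonom [:: l])) = 0.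
Proof.
move=> u0 v0; rewrite /assoc_defect /associator ins_mon_letter ins_leibniz.
rewrite ins_mon_letter -iterD (ins_homog_letter _ (ins_mon_homog v u0)) addrK.
rewrite (mon_mul u v) ins_mon_letter /= wt_cat -mon_mul.
have -> : absz (wt u + wt v) = (absz (wt u) + absz (wt v))%N by lia.
by rewrite mulrA subrr.
Qed.

(** The commutator of two derivations is a derivation: the mixed terms cancel. *)
Lemma ins_ins_leibniz x y z z' :
  let D := fun z => ins x (ins y z) - ins y (ins x z) in
  D (z * z') = D z * z' + z * D z'.
Proof.
rewrite /= !ins_leibniz !insDr !ins_leibniz [X in _ - X]addrACA.
rewrite mulrBl mulrBr !opprD !addrA.
by rewrite [LHS](ACl ((2*6)*(3*7)*(1*5*4*8))) /= !subrr !add0r.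
Qed.

(** For words x and y the antisymmetrized defect is a difference of two
    derivations in its last argument, so its vanishing on letters suffices. The
    defect itself is not a derivation. *)
Lemma assoc_defect_sym x y z :
    word_span (fun w => wt w <= 0) x -> word_span (fun w => wt w <= 0) y ->
  assoc_defect x y z = assoc_defect y x z.
Proof.
move=> + y0; move: x; apply: linear_span_min => [|a x x' IHx IHx'|_ [u u0 ->]].
- by rewrite assoc_defect0l assoc_defect0r.
- by rewrite assoc_defectZDl assoc_defectZDr IHx IHx'.
move: y y0; apply: linear_span_min => [|a y y' IHy IHy'|_ [v v0 ->]].
- by rewrite assoc_defect0l assoc_defect0r.
- by rewrite assoc_defectZDl assoc_defectZDr IHy IHy'.
set x := mon u; set y := mon v.
(* D_T is the derivation that has to coincide with the commutator of D_x and
   D_y; the antisymmetrized defect is the difference of the two. *)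
pose T := bracket x y + ins x y - ins y x.
have defectE z' : assoc_defect x y z' - assoc_defect y x z' =
    (ins x (ins y z') - ins y (ins x z')) - ins T z'.
  rewrite /T /bracket insBl insDl insBl /assoc_defect /associator.
  by rewrite !opprD !opprK !addrA [LHS](ACl (1*4*3*6*2*5)).
have defectM z1 z2 : assoc_defect x y z1 = assoc_defect y x z1 ->
    assoc_defect x y z2 = assoc_defect y x z2 ->
    assoc_defect x y (z1 * z2) = assoc_defect y x (z1 * z2).
  move=> /eqP; rewrite -subr_eq0 defectE subr_eq0 => /eqP e1.
  move=> /eqP; rewrite -subr_eq0 defectE subr_eq0 => /eqP e2.
  apply/eqP; rewrite -subr_eq0 defectE ins_ins_leibniz e1 e2.
  by rewrite -ins_leibniz subrr.
elim/mon_ind: z => [|a z z' IHz IHz'|[s]].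
- by rewrite /assoc_defect /associator !ins0r subrr.
- have Z a' b z1 z2 : assoc_defect a' b (a *: z1 + z2) =
      a *: assoc_defect a' b z1 + assoc_defect a' b z2.
    rewrite /assoc_defect /associator !insZDr !scalerBr !opprD.
    by rewrite [X in X + _ = _]addrACA [LHS]addrACA.
  by rewrite !Z IHz IHz'.
elim: s => [|l s IH].
  by rewrite mon_nil /assoc_defect /associator !ins1r !ins0r.
rewrite -cat1s mon_cat; apply: defectM => //.
by rewrite !assoc_defect_letter.
Qed.

Lemma ins_post_lie_associator x y z :
    word_span (fun w => wt w <= 0) x -> word_span (fun w => wt w <= 0) y ->
  ins (bracket x y) z = associator ins x y z - associator ins y x z.
Proof.
move=> x0 y0; have := assoc_defect_sym z x0 y0; rewrite /assoc_defect => /eqP.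
rewrite subr_eq => /eqP->; rewrite /bracket insBl.
by rewrite [RHS](ACl ((3*2)*(1*4))) /= subrr addr0.
Qed.

(** * First passage words and closure *)

Lemma word_span_cat_subalgebra P :
    (forall u v, P u -> P v -> P (FMonom (u ++ v))) ->
  lie_subalgebra (@bracket k R) (word_span P).
Proof.
move=> Pcat; have spanM x y : word_span P x -> word_span P y -> word_span P (x * y).
  move=> + Py; move: x; apply: linear_span_min => [|a x x' Px Px'|_ [u Pu ->]].
  - by rewrite mul0r; apply: linear_span0.
  - by rewrite mulrDl -scalerAl; apply: linear_spanZD.
  move: y Py; apply: linear_span_min => [|a y y' Py Py'|_ [v Pv ->]].
  - by rewrite mulr0; apply: linear_span0.
  - by rewrite mulrDr -scalerAr; apply: linear_spanZD.
  by rewrite mon_mul; apply/word_span_mon/Pcat.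
split; first exact: linear_span0.
  by move=> *; apply: linear_spanZD.
move=> x y Px Py; rewrite /bracket addrC -scaleN1r.
by apply: linear_spanZD; apply: spanM.
Qed.

(** On the walk with steps the weights of the letters. The case q = 0 forces the
    final height to be negative. *)
Definition first_passage s : Prop :=
  (0 < size s)%N /\ forall q, (q < size s)%N -> wt s < wt (take q s).

Lemma first_passage_wt s : first_passage s -> wt s < 0.
Proof. by case=> s0 /(_ 0%N s0); rewrite take0 wt_nil. Qed.

(** The first walk stays above its final height, and the second one, which starts
    there, descends strictly. *)
Lemma first_passage_cat s t :
  first_passage s -> first_passage t -> first_passage (s ++ t).
Proof.
move=> s1 t1; have tn := first_passage_wt t1; case: s1 t1 => s0 sp [t0 tp].
split=> [|q]; rewrite size_cat ?addn_gt0 ?s0 // take_cat wt_cat => qst.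
case: (ltnP q (size s)) => [/sp|sq]; first by lia.
by rewrite wt_cat; have := tp (q - size s)%N; lia.
Qed.

Lemma generating_wt_take s q :
  generating_word (FMonom s) -> (q < size s)%N -> 0 <= wt (take q s).
Proof. by case=> _ sp; case: q => [|q]; [rewrite take0 wt_nil | apply: sp]. Qed.

Lemma generating_first_passage s : generating_word (FMonom s) -> first_passage s.
Proof.
move=> s1; have [/= sE _] := s1; split=> [|q /(generating_wt_take s1)]; last by lia.
by case: s sE {s1} => //; rewrite wt_nil.
Qed.

Lemma take_size_add (T : Type) n (r1 r2 : seq T) :
  take (size r1 + n) (r1 ++ r2) = r1 ++ take n r2.
Proof. by rewrite take_cat ltnNge leq_addr /= addKn. Qed.

(** The walk of s ++ l :: t is nonnegative before its end. Raising l by -wt u lifts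
    it by this amount, the walk of u then consumes the lift, fully only at its
    end, and the remainder of the walk is the original one. *)
Lemma generating_insert s l t (u : seq letter) :
    generating_word (FMonom (s ++ l :: t)) -> first_passage u ->
  generating_word (FMonom (s ++ iter `|wt u|%N partial l :: u ++ t)).
Proof.
move=> y1 u1; have un := first_passage_wt u1; have [_ up] := u1.
have yp := generating_wt_take y1; have [/= yE _] := y1.
have wE : wt (s ++ l :: t) = wt s + letter_wt l + wt t.
  by rewrite wt_cat wt_cons addrA.
split=> /= [|q _].
  by move: yE; rewrite wE !(wt_cat, wt_cons) letter_wt_iter; lia.
rewrite !size_cat /= size_cat take_cat; case: (ltnP q (size s)) => [qs _|sq].
  by have := yp q; rewrite size_cat /= take_cat qs; apply; lia.
case E: (q - size s)%N => [|r] qst /=.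
  by have := yp (size s); rewrite size_cat /= take_size_cat // cats0; apply; lia.
rewrite !(wt_cat, wt_cons) letter_wt_iter take_cat.
case: (ltnP r (size u)) => [/up ru|ur].
  (* When t is empty the walk is at -1 after l, and only the strict inequality
     for the proper prefixes of u keeps the new walk nonnegative. *)
  have sl : -1 <= wt s + letter_wt l.
    case: t => [|l' t] in wE yE yp {y1 qst} *; first by rewrite wt_nil in wE; lia.
    have := yp (size s + 1)%N; rewrite take_size_add size_cat /=.
    by rewrite wt_cat wt_cons wt_nil; lia.
  by lia.
have := yp (size s + (r - size u).+1)%N.
by rewrite take_size_add size_cat /= !wt_cat wt_cons; lia.
Qed.

(** The first argument is controlled through the larger space F, the span of the
    first passage words, since the set of x such that x |> - preserves the
    generated Lie algebra is not visibly closed under the bracket: the post-Lie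
    identity for [x, x'] involves insertions of x |> x'. The second argument is
    controlled by the derivation property. *)
Lemma ins_generated_closed x y :
  let G := lie_generated (@bracket k R) (word_span (fun w => wt w <= 0))
             (word_span (@generating_word A)) in
  G x -> G y -> G (ins x y).
Proof.
set M := word_span (fun w => wt w <= 0); set V := word_span (@generating_word A).
move=> G Gx Gy.
have Gsub : lie_subalgebra (@bracket k R) G by apply: lie_generated_lie_subalgebra.
pose F := word_span (fun w => first_passage w).
have VF z : V z -> F z.
  by apply: word_spanS => -[s]; apply: generating_first_passage.
have FM z : F z -> M z.
  by apply: word_spanS => w /first_passage_wt/ltW.
have Msub : lie_subalgebra (@bracket k R) M.
  apply: word_span_cat_subalgebra => u v u0 v0.
  by rewrite wt_cat -(addr0 0); apply: lerD.
have Fx : F x.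
  apply: Gx => //; apply: word_span_cat_subalgebra => u v.
  exact: first_passage_cat.
have xV z : V z -> V (ins x z).
  move=> Vz; move: x Fx {Gx}; apply: linear_span_min.
  - by rewrite ins0l; apply: linear_span0.
  - by move=> a x x' Vx Vx'; rewrite insZDl; apply: linear_spanZD.
  move=> _ [u u1 ->]; move: z Vz; apply: linear_span_min.
  - by rewrite ins0r; apply: linear_span0.
  - by move=> a z z' Vz Vz'; rewrite insZDr; apply: linear_spanZD.
  move=> _ [v v1 ->]; apply: word_span_ins => s l t vE.
  by apply: generating_insert => //; rewrite -vE fmK.
have GV z : V z -> G z by move=> Vz S _ _; apply.
have GM z : G z -> M z by apply=> // ? /VF/FM.
have [G0 GZD Gbr] := Gsub.
suff [] : G y /\ G (ins x y) by [].
apply: (Gy (fun z => G z /\ G (ins x z))) => [|z [/GM]|z Vz] //; last first.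
  by split; apply: GV => //; apply: xV.
split; first by rewrite ins0r.
  by move=> a z z' [Gz Gxz] [Gz' Gxz']; rewrite insZDr; split; apply: GZD.
move=> z z' [Gz Gxz] [Gz' Gxz']; split; first exact: Gbr.
rewrite ins_bracket -[bracket _ _]scale1r; apply: GZD; exact: Gbr.
Qed.

End WordAlgebra.

(** * The post-Lie algebra *)

(** The associator identity of the ambient product is required only on a subset S,
    because for insertion its proof needs weights at most 0. *)
Lemma post_lie_pullback (k : fieldType) (L M : lmodType k) (f : {linear L -> M})
    (S : M -> Prop) (trL brL : L -> L -> L) (trM brM : M -> M -> M) :
    injective f -> (forall x, S (f x)) ->
    (forall x y, f (brL x y) = brM (f x) (f y)) ->
    (forall x y, f (trL x y) = trM (f x) (f y)) ->
    lie_algebra brM -> bilinear_op trM ->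
    (forall x y z, trM x (brM y z) = brM (trM x y) z + brM y (trM x z)) ->
    (forall x y z, S x -> S y ->
       trM (brM x y) z = associator trM x y z - associator trM y x z) ->
  post_lie_algebra trL brL.
Proof.
move=> f_inj Sf fbr ftr [[brr brl] bralt brjac] [trr trl] trbr trass.
split.
- split.
  + split=> [x a y z|y a x z]; apply: f_inj.
      by rewrite fbr !linearP brr !fbr.
    by rewrite /= fbr !linearP (brl _ a) !fbr.
  + by move=> x; apply: f_inj; rewrite fbr bralt linear0.
  + by move=> x y z; apply: f_inj; rewrite !linearD !fbr brjac linear0.
- split=> [x a y z|y a x z]; apply: f_inj.
    by rewrite ftr !linearP trr !ftr.
  by rewrite /= ftr !linearP (trl _ a) !ftr.
- by move=> x y z; apply: f_inj; rewrite linearD !(ftr, fbr) trbr.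
move=> x y z; apply: f_inj; rewrite /associator !linearB !(ftr, fbr) /=.
by rewrite trass // /associator opprD.
Qed.

Section Insertion.
Variables (k : fieldType) (A : finType).
Local Notation word := (word A).
Local Notation PN := (PN k A).
Implicit Types (x y z : PN) (u v : word).

Let mon (w : word) : PN := << w >>.

Fact malg_mon_nil : mon (FMonom [::]) = 1.
Proof. by rewrite /mon -fmoneE. Qed.

Fact malg_mon_cat (s t : seq (letter A)) :
  mon (FMonom (s ++ t)) = mon (FMonom s) * mon (FMonom t).
Proof.
rewrite /mon malgM_def fgmulUU mulr1; congr << _ >>.
by rewrite -[RHS]fmK fmM.
Qed.

Lemma insertionE x y :
  insertion x y =
    \sum_(v <- msupp x) x@_v *: (\sum_(w <- msupp y) y@_w *: insert_word k v w).
Proof.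
apply: eq_bigr => v _; rewrite scaler_sumr.
by apply: eq_bigr => w _; rewrite scalerA.
Qed.

Lemma insertionZDl (a : k) x y z :
  insertion (a *: x + y) z = a *: insertion x z + insertion y z.
Proof. by rewrite !insertionE malg_sum_linear. Qed.

Lemma insertionZDr (a : k) x y z :
  insertion x (a *: y + z) = a *: insertion x y + insertion x z.
Proof.
rewrite !insertionE scaler_sumr -big_split; apply: eq_bigr => v _ /=.
by rewrite malg_sum_linear scalerDr !scalerA mulrC.
Qed.

Lemma insertion_mon u v : insertion (mon u) (mon v) = insert_word k u v.
Proof.
by rewrite insertionE !msuppU1 !big_seq_fset1 !mcoeffUU !scale1r.
Qed.

Let PNalg : algType k := malg_algType word k.

Lemma insertion_in_g x y : in_g x -> in_g y -> in_g (insertion x y).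
Proof.
exact (@ins_generated_closed k A PNalg mon (@insertion k A)
  malg_mon_nil malg_mon_cat (@malg_ind _ _) insertionZDl insertionZDr
  insertion_mon x y).
Qed.

Lemma in_g_le0 x : in_g x -> PN_le0 x.
Proof.
apply=> //.
  apply: (@word_span_cat_subalgebra k A PNalg mon malg_mon_cat) => u v u0 v0.
  by rewrite wt_cat -(addr0 0); apply: lerD.
by move=> y; apply: (@word_spanS k A PNalg mon) => w [->].
Qed.

End Insertion.

Theorem theorem2p9 (k : fieldType) (char0 : [pchar k] =i pred0) (A : finType) :
  exists tr : g k A -> g k A -> g k A,
    (forall x y : g k A, g_val (tr x y) = insertion (g_val x) (g_val y)) /\
    post_lie_algebra tr (@g_bracket k A).
Proof.
have tr_subproof (x y : g k A) : insertion (g_val x) (g_val y) \in @g_pred k A.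
  have gP (z : g k A) : in_g (g_val z) by exact: (elimT (g_predP _) (g_valP z)).
  apply/g_predP; exact: insertion_in_g.
exists (fun x y => G (tr_subproof x y)); split=> //.
pose PNalg : algType k := malg_algType (word A) k.
apply: (@post_lie_pullback _ _ _ (val : {linear g k A -> PN k A}) (@PN_le0 k A)
          _ _ (@insertion k A) (@commutator k A)) => //.
- exact: val_inj.
- by move=> x; apply: in_g_le0; exact: (g_predP _ (g_valP x)).
- exact: (@bracket_lie_algebra k PNalg).
- by split=> [x a y z|z a x y]; rewrite ?insertionZDr ?insertionZDl.
- exact: (@ins_bracket k A PNalg _ _ (@malg_mon_nil k A)
            (@malg_mon_cat k A) (@malg_ind _ _) (@insertionZDl k A)
            (@insertionZDr k A) (@insertion_mon k A)).
exact: (@ins_post_lie_associator k A PNalg _ _ (@malg_mon_nil k A)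
            (@malg_mon_cat k A) (@malg_ind _ _) (@insertionZDl k A)
            (@insertionZDr k A) (@insertion_mon k A)).
Qed.
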